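(* Let $p$ be an odd prime number and $\mathcal{F}$ be a saturated fusion system on a finite $p$-group $S$. Suppose that every maximal subgroup of $S$ is weakly $\mathcal{F}$-closed. If $S$ is not cyclic, suppose moreover that $S$ has more than one abelian maximal subgroup. Then $\mathcal{F}$ is supersolvable.
   Context: Let $p$ be a prime and $S$ a finite $p$-group. A fusion system $\mathcal{F}$ on $S$ is a category whose objects are the subgroups of $S$ and whose morphism sets $\mathrm{Hom}_{\mathcal{F}}(P,Q)$ consist of injective group homomorphisms $P \to Q$ (with usual composition), contain all homomorphisms $P \to Q$ induced by conjugation by elements of $S$, and are such that each $\varphi \in \mathrm{Hom}_{\mathcal{F}}(P,Q)$ factors as an $\mathcal{F}$-isomorphism $P \to \varphi(P)$ followed by an inclusion. Subgroups $P,Q$ are $\mathcal{F}$-conjugate if they are isomorphic in $\mathcal{F}$. $\mathcal{F}$ is saturated if every subgroup of $S$ is $\mathcal{F}$-conjugate to a subgroup $Q$ that is fully automized ($\mathrm{Aut}_S(Q) \in \mathrm{Syl}_p(\mathrm{Aut}_{\mathcal{F}}(Q))$) and receptive (each $\mathcal{F}$-isomorphism $\varphi : P \to Q$ with $P \le S$ extends to an $\mathcal{F}$-morphism $N_\varphi \to S$, where $N_\varphi = \{ g \in N_S(P) : \varphi c_g \varphi^{-1} \in \mathrm{Aut}_S(Q)\}$). A subgroup $Q \le S$ is weakly $\mathcal{F}$-closed if $\varphi(Q) = Q$ for all $\varphi \in \mathrm{Hom}_{\mathcal{F}}(Q,S)$; it is strongly $\mathcal{F}$-closed if for every $P \le Q$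 and $\varphi \in \mathrm{Hom}_{\mathcal{F}}(P,S)$ one has $\varphi(P) \le Q$. A saturated fusion system $\mathcal{F}$ on $S$ is supersolvable if there is a series $1 = S_0 \le S_1 \le \dots \le S_m = S$ of subgroups of $S$ such that $S_i$ is strongly $\mathcal{F}$-closed for all $0 \le i \le m$ and $S_{i+1}/S_i$ is cyclic for all $0 \le i < m$. *)

(* Defs.v *)
From mathcomp Require Import all_boot all_fingroup all_solvable.

Set Implicit Arguments.
Unset Strict Implicit.
Unset Printing Implicit Defensive.

Import GroupScope.

(* The objects are the subgroups of S, viewed as groups inside the ambient
   type gT.  A morphism P -> Q is represented by a function gT -> gT of which
   only the values on P are relevant ([fus_hom_ext]).  Since there are finitely
   many maps P -> Q, taking the Hom-sets to be boolean is no restriction. *)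
Record fusion_system (gT : finGroupType) (S : {group gT}) := FusionSystem {
  fus_hom : {group gT} -> {group gT} -> pred (gT -> gT);
  fus_hom_ext : forall (P Q : {group gT}) (f g : gT -> gT),
    {in P, f =1 g} -> fus_hom P Q f -> fus_hom P Q g;
  fus_hom_obj : forall (P Q : {group gT}) (f : gT -> gT),
    fus_hom P Q f -> P \subset S /\ Q \subset S;
  fus_hom_inj_morph : forall (P Q : {group gT}) (f : gT -> gT),
    fus_hom P Q f ->
    [/\ {in P &, {morph f : x y / x * y}}, {in P &, injective f}
      & f @: P \subset Q];
  fus_hom_comp : forall (P Q R : {group gT}) (f g : gT -> gT),
    fus_hom P Q f -> fus_hom Q R g -> fus_hom P R (g \o f);
  (* x = 1 gives the identities and the inclusions. *)
  fus_hom_conj : forall (P Q : {group gT}) (x : gT),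
    P \subset S -> Q \subset S -> x \in S -> P :^ x \subset Q ->
    fus_hom P Q (conjg^~ x);
  (* Every morphism P -> Q restricts to an isomorphism P -> f(P); composing it
     with the inclusion of f(P) in Q gives back f. *)
  fus_hom_factor : forall (P Q : {group gT}) (f : gT -> gT),
    fus_hom P Q f ->
    exists R : {group gT},
      [/\ R :=: f @: P, fus_hom P R f
        & exists2 g : gT -> gT, fus_hom R P g
          & {in P, cancel f g} /\ {in R, cancel g f}]
}.

Section FusionSystems.

Variables (gT : finGroupType) (S : {group gT}).
Implicit Types (P Q R : {group gT}) (f g : gT -> gT).

Definition Aut_by P Q : {set {perm gT}} := conj_aut Q @* 'N_P(Q).

(* The elements g of N_S(P) such that f c_g f^-1 = a for some a in Aut_S(Q). *)
Definition ext_dom P Q f : {set gT} :=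
  [set g in 'N_S(P) |
    [exists a in Aut_by S Q, [forall x in P, f (x ^ g) == a (f x)]]].

Lemma ext_dom_group_set P Q f : group_set (ext_dom P Q f).
Proof.
apply/group_setP; split=> [|g h].
  rewrite inE group1; apply/existsP; exists 1; rewrite group1 /=.
  by apply/forall_inP=> x _; rewrite conjg1 perm1.
rewrite inE => /andP[Ng /exists_inP[a Sa /forall_inP fa]].
rewrite inE => /andP[Nh /exists_inP[b Sb /forall_inP fb]].
rewrite inE groupM //; apply/exists_inP; exists (a * b); first by rewrite groupM.
apply/forall_inP=> x Px; have [_ nPg] := setIP Ng.
by rewrite conjgM (eqP (fb _ _)) ?memJ_norm // (eqP (fa _ Px)) permM.
Qed.

Canonical ext_dom_group P Q f := Group (ext_dom_group_set P Q f).

Variable F : fusion_system S.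

Definition fus_iso P Q f : Prop :=
  fus_hom F P Q f /\
  exists2 g, fus_hom F Q P g & {in P, cancel f g} /\ {in Q, cancel g f}.

Definition fus_conj P Q : Prop := exists f, fus_iso P Q f.

Definition fus_Aut Q : {set {perm gT}} := [set a in Aut Q | fus_hom F Q Q a].

Definition fully_automized (p : nat) Q : bool :=
  p.-Sylow(fus_Aut Q) (Aut_by S Q).

Definition receptive Q : Prop :=
  forall P f, fus_iso P Q f ->
  exists2 g, fus_hom F (ext_dom_group P Q f) S g & {in P, g =1 f}.

Definition saturated (p : nat) : Prop :=
  forall P, P \subset S ->
  exists Q, [/\ fus_conj P Q, fully_automized p Q & receptive Q].

Definition weakly_closed Q : Prop :=
  Q \subset S /\ forall f, fus_hom F Q S f -> f @: Q = Q.

Definition strongly_closed Q : Prop :=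
  Q \subset S /\
  forall P f, P \subset Q -> fus_hom F P S f -> f @: P \subset Q.

(* Each T i is strongly closed, hence normal in S, so T i.+1 / T i is the
   ordinary quotient group. *)
Definition supersolvable : Prop :=
  exists (m : nat) (T : nat -> {group gT}),
    [/\ T 0 :=: 1, T m :=: S,
        forall i, i < m -> T i \subset T i.+1,
        forall i, i <= m -> strongly_closed (T i)
      & forall i, i < m -> cyclic (T i.+1 / T i)].

End FusionSystems.

(* Main.v *)
Require Import Defs.
From mathcomp Require Import all_boot all_fingroup all_solvable.

Set Implicit Arguments.
Unset Strict Implicit.
Unset Printing Implicit Defensive.

Import GroupScope.

(* If S is not abelian, the two abelian maximal subgroups give |S : Z(S)| = p^2
   and |S'| = p.  For an abelian maximal subgroup M, if Aut_S(M) is not normal in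
   Aut_F(M), then two of its conjugates generate a copy of SL_2(p) whose central
   involution t centralises Aut_S(M), hence extends to S, where it is trivial on
   S/M but inverts an element of M outside Z(S).  As t preserves all maximal
   subgroups and p is odd, this is absurd.  So every F-automorphism of M, and
   then every F-morphism, extends to an F-automorphism of S, and strongly closed
   means Aut_F(S)-invariant.  Since Aut_F(S) fixes the maximal subgroups, it
   preserves all the subgroups <x>Phi(S), which produces the series of invariant
   subgroups above S'. *)

(** * Groups with center of index p^2 *)

Section PGroups.

Variables (p : nat) (gT : finGroupType).
Hypothesis p_pr : prime p.
Implicit Types (G H P S M N : {group gT}) (x y : gT).

(** Since it centralizes [P], the conjugate [P :^ x] generates with [P] a p-subgroup of [G], which
    must be [P] itself. So [x] normalizes [P], and [P <*> <[x]>] is again a p-subgroup. *)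
Lemma Sylow_p_elt_cent G P x :
  p.-Sylow(G) P -> x \in G -> p.-elt x -> P :^ x \subset 'C(P) -> x \in P.
Proof.
move=> sylP Gx px cPPx; have [sPG pP _] := and3P sylP.
have pPx : p.-group (P :^ x) by rewrite pgroupJ.
have defP : P <*> P :^ x = P.
  apply: (sub_pHall sylP) => /=; last 2 first.
  - exact: joing_subl.
  - by rewrite join_subG sPG -(conjGid Gx) conjSg.
  by rewrite cent_joinEr // pgroupM pP.
have nPx : x \in 'N(P) by have:= joing_subr P (P :^ x); rewrite defP inE.
have defPx : P <*> <[x]> = P.
  apply: (sub_pHall sylP) => /=; last 2 first.
  - exact: joing_subl.
  - by rewrite join_subG sPG cycle_subG.
  by rewrite norm_joinEr ?cycle_subG // pgroupM pP.
by rewrite -cycle_subG -[gval P]defPx joing_subr.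
Qed.

(** The quotient [S / N] is elementary abelian, so the cyclic group generated by the image of [x]
    has a complement in it; [M] is the preimage of that complement. *)
Lemma maximal_avoiding S N x :
  p.-group S -> 'Phi(S) \subset N -> N \subset S -> x \in S -> x \notin N ->
  exists M : {group gT}, [/\ maximal M S, N \subset M & x \notin M].
Proof.
move=> pS sPhiN sNS Sx N'x.
have nNS : S \subset 'N(N).
  rewrite sub_der1_norm // (subset_trans _ sPhiN) //.
  by rewrite (Phi_joing pS) joing_subl.
have nsN : N <| S by rewrite /normal sNS.
have nNx := subsetP nNS x Sx.
have abS : p.-abelem (S / N).
  have nsPhi : 'Phi(S) <| S by apply: Phi_normal.
  rewrite -(isog_abelem (third_isog sPhiN nsPhi nsN)).
  by rewrite quotient_abelem ?Phi_quotient_abelem.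
have xS : coset N x \in S / N by rewrite mem_quotient.

have ntx : coset N x != 1.
  by apply: contra N'x => /eqP/coset_idr->.
have [C [sCS _ defS]] := p_abelem_split1 abS xS.
have [_ _ _ tiC] := dprodP defS.
exists (coset N @*^-1 C)%G; split.
- rewrite -(quotientGK nsN) cosetpre_maximal p_index_maximal //.
  rewrite -divgS // -(dprod_card defS) mulnK ?cardG_gt0 //.
  by rewrite -orderE (abelem_order_p abS).
- by rewrite -{1}(ker_coset N) kerE morphpreS ?sub1G.
apply: contra ntx => /morphpreP[_ Cx].
by rewrite -cycle_eq1 -subG1 -tiC subsetI subxx cycle_subG.
Qed.

Section CentralIndexP2.

Variable S : {group gT}.
Hypotheses (pS : p.-group S) (oSZ : #|S : 'Z(S)| = (p ^ 2)%N).
Local Notation Z := 'Z(S).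

Lemma card_central_quotient : #|S / Z| = (p ^ 2)%N.
Proof. by rewrite card_quotient ?normal_norm ?center_normal. Qed.

Lemma der1_sub_center : S^`(1) \subset Z.
Proof.
rewrite der1_min ?normal_norm ?center_normal //.
exact: card_p2group_abelian p_pr card_central_quotient.
Qed.

Lemma index_center_nonabelian : ~~ abelian S.
Proof.
apply/negP=> /center_idP defZ.
have := oSZ; rewrite defZ indexgg => /eqP.
by rewrite eq_sym -(expn0 p) eqn_exp2l ?prime_gt1.
Qed.

Lemma expgp_center x : x \in S -> x ^+ p \in Z.
Proof.
move=> Sx; have nZ := normal_norm (center_normal S).
have nZx := subsetP nZ x Sx.
have oxd : #[coset Z x] %| p ^ 2.
  by rewrite -card_central_quotient order_dvdG ?mem_quotient.
suffices oxp : #[coset Z x] %| p.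
  apply: coset_idr; first exact: groupX.
  by rewrite morphX //; apply/eqP; rewrite -order_dvdn.
have /(dvdn_pfactor _ _ p_pr)[] := oxd.
case=> [|[|[|//]]] _ ox.
- by rewrite ox dvd1n.
- by rewrite ox dvdnn.
(* In the remaining case the coset has order p^2, so [S / Z] would be cyclic and [S] abelian. *)
case/negP: index_center_nonabelian; apply: cyclic_center_factor_abelian.
apply/cyclicP; exists (coset Z x); apply/esym/eqP.
by rewrite eqEcard cycle_subG mem_quotient // card_central_quotient -orderE ox /=.
Qed.

Lemma index_over_center (M : {group gT}) :
  Z \subset M -> M \subset S -> [\/ M :=: S, M :=: Z | maximal M S].
Proof.
move=> sZM sMS; have := Lagrange_index sMS sZM; rewrite oSZ => dM.
have /(dvdn_pfactor _ _ p_pr) : #|S : M| %| p ^ 2 by rewrite -dM dvdn_mulr.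
case=> [[|[|[|//]]] _ oM].
- by constructor 1; apply/eqP; rewrite eqEsubset sMS -indexg_eq1 oM expn0.
- by constructor 3; rewrite p_index_maximal // oM expn1.
- constructor 2; apply/eqP; rewrite eqEsubset sZM andbT -indexg_eq1.
  move/eqP: dM; rewrite oM -[X in _ == X]muln1 eqn_pmul2l //.
  by rewrite expn_gt0 prime_gt0.
Qed.

(** This subgroup is abelian, hence not [S], and it contains the noncentral [x], hence is not
    [Z]. *)
Lemma maximal_center_cycle x : x \in S -> x \notin Z -> maximal (Z <*> <[x]>) S.
Proof.
move=> Sx Z'x.
have sZxS : Z <*> <[x]> \subset S by rewrite join_subG center_sub cycle_subG.
have [/= defS | defZ | //] :=
  @index_over_center (Z <*> <[x]>)%G (joing_subl _ _) sZxS.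
  case/negP: index_center_nonabelian; rewrite -defS.
  rewrite abelianY center_abelian cycle_abelian /=.
  by rewrite cycle_subG; apply: subsetP Sx; rewrite centsC subsetIr.
by case/negP: Z'x; have := joing_subr Z <[x]>; rewrite defZ cycle_subG.
Qed.

Lemma center_cycleP x y :
  x \in S -> y \in Z <*> <[x]> -> exists2 z, z \in Z & exists i, y = z * x ^+ i.
Proof.
move=> Sx; rewrite norm_joinEr => [/mulsgP[z _ Zz /cycleP[i ->] ->]|].
  by exists z => //; exists i.
by rewrite cycle_subG (subsetP (normal_norm (center_normal S))).
Qed.

(** Write y = z x^i with z central. If p divides i, then x^i is central; otherwise x^i generates
    [<[x]>], and [y] in [M] would force [x] into [M]. *)
Lemma center_cycle_cap (M : {group gT}) x y :
  Z \subset M -> x \in S -> x \notin M ->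
  y \in Z <*> <[x]> -> y \in M -> y \in Z.
Proof.
move=> sZM Sx M'x /(center_cycleP Sx)[z Zz [i ->]].
rewrite (groupMl _ (subsetP sZM _ Zz)) (groupMl _ Zz) => Mxi.
have [dv_pi | ndv_pi] := boolP (p %| i).
  by case/dvdnP: dv_pi => j ->; rewrite mulnC expgM groupX ?expgp_center.
case/negP: M'x; rewrite -cycle_subG.
have: generator <[x]> (x ^+ i).
  have [k ox] := p_natP (mem_p_elt pS Sx).
  by rewrite generator_coprime ox coprimeXl // prime_coprime.
by move/eqP->; rewrite cycle_subG.
Qed.

(** [S] is generated by [Z] and two elements [x], [y], so the derived subgroup is generated by the
    central element [[~ x, y]], whose p-th power is [[~ x ^+ p, y]], which is trivial. *)
Lemma card_der1 : #|S^`(1)| = p.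
Proof.
have [x Sx Z'x] : exists2 x, x \in S & x \notin Z.
  apply/subsetPn; apply/negP=> sSZ; case/negP: index_center_nonabelian.
  exact: subset_trans sSZ (subsetIr _ _).
have maxX := maximal_center_cycle Sx Z'x.
have [sXS [y Sy X'y]] := properP (maxgroupp maxX).
have defS : Z * (<[x]> <*> <[y]>) = S.
  have sXYS : <[x]> <*> <[y]> \subset S by rewrite join_subG !cycle_subG Sx.
  have nZXY := subset_trans sXYS (normal_norm (center_normal S)).
  rewrite -norm_joinEr //; apply/eqP.
  rewrite eqEsubset join_subG center_sub sXYS /=.
  (* Otherwise this proper subgroup would coincide with the maximal [Z <*> <[x]>], which misses
     [y]. *)
  apply/negPn/negP=> not_sS; have [_ maxP] := maxgroupP maxX.
  case/negP: X'y; rewrite -(maxP (Z <*> (<[x]> <*> <[y]>))%G) /=.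
  - by rewrite mem_gen // inE (mem_gen (_ : y \in _)) ?orbT // inE cycle_id orbT.
  - by rewrite properE not_sS andbT join_subG center_sub.
  by rewrite genS // setUS // joing_subl.
have sXYS : <[x]> <*> <[y]> \subset S by rewrite join_subG !cycle_subG Sx.
have cZXY : <[x]> <*> <[y]> \subset 'C(Z).
  by rewrite (subset_trans sXYS) // centsC subsetIr.
have prodS : Z \* (<[x]> <*> <[y]>) = S by rewrite cprodE.
have Zc : [~ x, y] \in Z by rewrite (subsetP der1_sub_center) ?mem_commg.
have defS' : S^`(1) = <[[~ x, y]]>.
  have /cprodP[_ <- _] := der_cprod 1 prodS.
  rewrite (derG1P (center_abelian S)) mul1g.
  by apply: der1_joing_cycles; rewrite (subsetP _ _ Zc) // centsC.
rewrite defS' -orderE; apply: nt_prime_order => //.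
  have [cx _] : commute x [~ x, y] /\ True.
    by split=> //; apply: (centerC Sx).
  rewrite -commXg // ; apply/eqP/commgP.
  exact/commute_sym/(centerC Sy)/expgp_center.
by rewrite -cycle_eq1 -defS'; apply: contra index_center_nonabelian => /eqP/derG1P.
Qed.

End CentralIndexP2.

End PGroups.

(** * Extending automorphisms of maximal subgroups *)

Section Fusion.

Variables (gT : finGroupType) (S : {group gT}) (F : fusion_system S).
Implicit Types (P Q R M : {group gT}) (f g : gT -> gT) (a b : {perm gT}).

(** * Elementary rules for F-morphisms *)

Lemma fus_hom_id P Q : P \subset Q -> Q \subset S -> fus_hom F P Q id.
Proof.
move=> sPQ sQS.
apply: (fus_hom_ext (f := conjg^~ 1)) => [x _|]; first exact: conjg1.
by apply: fus_hom_conj; rewrite ?conjsg1 // (subset_trans sPQ).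
Qed.

Lemma fus_hom_sub P P' Q Q' f :
  P' \subset P -> Q \subset Q' -> Q' \subset S -> fus_hom F P Q f ->
  fus_hom F P' Q' f.
Proof.
move=> sP sQ sQ'S homf; have [sPS _] := fus_hom_obj homf.
apply: (fus_hom_comp (g := id)) (fus_hom_id sQ sQ'S).
exact: (fus_hom_comp (f := id)) (fus_hom_id sP sPS) homf.
Qed.

Lemma fus_hom_iso P Q R f : fus_hom F P Q f -> R :=: f @: P -> fus_iso F P R f.
Proof.
move=> homf defR; have [R' [defR' homf' [g homg cfg]]] := fus_hom_factor homf.
have eqR : R = R' by apply: val_inj; rewrite /= defR.
by rewrite eqR; split=> //; exists g.
Qed.

Lemma fus_iso_image P Q f : fus_iso F P Q f -> f @: P = Q.
Proof.
case=> homf [g homg [_ cgf]]; have [_ _ sfPQ] := fus_hom_inj_morph homf.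
have [_ _ sgQP] := fus_hom_inj_morph homg.
apply/eqP; rewrite eqEsubset sfPQ; apply/subsetP=> y Qy.
by rewrite -[y]cgf // imset_f // (subsetP sgQP) // imset_f.
Qed.

Lemma fus_iso_comp P Q R f g :
  fus_iso F P Q f -> fus_iso F Q R g -> fus_iso F P R (g \o f).
Proof.
move=> isof isog; have [[homf _] [homg _]] := (isof, isog).
apply: fus_hom_iso (fus_hom_comp homf homg) _.
by rewrite imset_comp (fus_iso_image isof) (fus_iso_image isog).
Qed.

Lemma fus_hom_morphM P Q f :
  fus_hom F P Q f -> {in P &, {morph f : x y / x * y}}.
Proof. by case/fus_hom_inj_morph. Qed.

Lemma fus_hom_inj P Q f : fus_hom F P Q f -> {in P &, injective f}.
Proof. by case/fus_hom_inj_morph. Qed.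

Lemma fus_hom_mem P Q f x : fus_hom F P Q f -> x \in P -> f x \in Q.
Proof.
by case/fus_hom_inj_morph=> _ _ /subsetP sfPQ Px; rewrite sfPQ ?imset_f.
Qed.

Lemma fus_hom_endo_image P f : fus_hom F P P f -> f @: P = P.
Proof.
case/fus_hom_inj_morph=> _ injf sfP; apply/eqP.
by rewrite eqEcard sfP card_in_imset /=.
Qed.

Lemma fus_hom1 P Q f : fus_hom F P Q f -> f 1 = 1.
Proof.
move/fus_hom_morphM => fM; apply: (mulgI (f 1)).
by rewrite -fM ?group1 // !mulg1.
Qed.

Lemma fus_homV P Q f : fus_hom F P Q f -> {in P, {morph f : x / x^-1}}.
Proof.
move=> homf x Px; apply: (mulgI (f x)).
by rewrite -(fus_hom_morphM homf) ?groupV // !mulgV (fus_hom1 homf).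
Qed.

Lemma fus_homX P Q f n : fus_hom F P Q f -> {in P, {morph f : x / x ^+ n}}.
Proof.
move=> homf x Px; elim: n => [|n IHn]; first by rewrite !expg0 (fus_hom1 homf).
by rewrite !expgS (fus_hom_morphM homf) ?groupX // IHn.
Qed.

Lemma fus_homJ P Q f : fus_hom F P Q f -> {in P &, {morph f : x y / x ^ y}}.
Proof.
move=> homf x y Px Py.
by rewrite !conjgE !(fus_hom_morphM homf) ?groupM ?groupV // (fus_homV homf).
Qed.

Lemma fus_hom_Aut P f :
  fus_hom F P P f -> exists2 a, a \in fus_Aut F P & {in P, a =1 f}.
Proof.
move=> homf; have fM := fus_hom_morphM homf.
have injf : 'injm (Morphism fM) by apply/injmP; exact: fus_hom_inj homf.
have imf : Morphism fM @* P = P.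
  by rewrite morphimEdom; exact: fus_hom_endo_image homf.
have eq_af : {in P, aut injf imf =1 f} by exact: autE.
exists (aut injf imf) => //; rewrite inE Aut_aut /=.
by apply: fus_hom_ext homf => x Px; rewrite eq_af.
Qed.

Lemma fus_Aut_group_set P : P \subset S -> group_set (fus_Aut F P).
Proof.
move=> sPS; apply/group_setP; split=> [|a b].
  rewrite inE group1 /=; apply: fus_hom_ext (fus_hom_id (subxx P) sPS) => x _.
  by rewrite perm1.
move=> /setIdP[Aa homa] /setIdP[Ab homb].
apply/setIdP; rewrite groupM //; split=> //.
by apply: fus_hom_ext (fus_hom_comp homa homb) => x _; rewrite /= permM.
Qed.

(** * F-automorphisms of maximal subgroups *)

Section MaximalExtension.

Variables (p : nat).
Hypotheses (p_pr : prime p) (p_odd : odd p) (pS : p.-group S).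
Hypothesis satF : saturated F p.
Hypothesis wclF : forall M : {group gT}, maximal M S -> weakly_closed F M.

Lemma maximal_fus_hom M f :
  maximal M S -> fus_hom F M S f -> fus_hom F M M f.
Proof.
move=> maxM homf; have [_ /(_ f homf) imf] := wclF maxM.
by case: (fus_hom_iso homf (esym imf)).
Qed.

(** Saturation provides a conjugate of [M] with both properties, and weak closure forces this
    conjugate to be [M]. *)
Lemma maximal_receptive M :
  maximal M S -> fully_automized F p M /\ receptive F M.
Proof.
move=> maxM; have [sMS clM] := wclF maxM.
have [Q [[f isof] autQ recQ]] := satF sMS.
suffices -> : M = Q by [].
have [homf _] := isof; have [_ sQS] := fus_hom_obj homf.
apply: val_inj; rewrite /= -(fus_iso_image isof).
by apply/esym/clM/(fus_hom_sub _ _ _ homf).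
Qed.

Hypothesis oSZ : #|S : 'Z(S)| = (p ^ 2)%N.
Variable M : {group gT}.
Hypotheses (maxM : maximal M S) (sZM : 'Z(S) \subset M).
Local Notation Z := 'Z(S).
Local Notation P := (Aut_by S M).

Let sMS : M \subset S. Proof. exact: proper_sub (maxgroupp maxM). Qed.
Let nMS : S \subset 'N(M).
Proof. exact: normal_norm (p_maximal_normal pS maxM). Qed.
Let G := Group (fus_Aut_group_set sMS).
Let sylP : p.-Sylow(G) (conj_aut M @* 'N_S(M)).
Proof. by have [] := maximal_receptive maxM. Qed.

(** [Z] has index p in [M], so [M] is a cyclic extension of a central subgroup. *)
Let cMM : abelian M.
Proof.
apply: (@cyclic_factor_abelian _ 'Z(S)%G).
  by rewrite subsetI sZM; apply: subset_trans (centS sMS); exact: subsetIr.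
rewrite prime_cyclic // card_quotient; last first.
  exact: subset_trans sMS (normal_norm (center_normal S)).
have := Lagrange_index sMS sZM; rewrite oSZ (p_maximal_index pS maxM) -mulnn.
by move/eqP; rewrite eqn_pmul2l ?prime_gt0 // => /eqP->.
Qed.

Let cM x y : x \in M -> y \in M -> x * y = y * x.
Proof. by move=> Mx My; exact: (centsP cMM). Qed.

Lemma Aut_by_conj h : h \in S -> conj_aut M h \in P.
Proof.
move=> Sh; have nMh := subsetP nMS h Sh.
by apply: mem_morphim => //; rewrite inE Sh.
Qed.

Lemma Aut_byP a : a \in P -> exists2 h, h \in S & {in M, a =1 conjg^~ h}.
Proof.
case/morphimP=> h nMh /setIP[Sh _] ->; exists h => // x Mx.
by rewrite norm_conj_autE.
Qed.

Lemma Aut_by_center a z : a \in P -> z \in Z -> a z = z.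
Proof.
move=> Pa Zz; have [h Sh ->] := Aut_byP Pa; last exact: (subsetP sZM).
by rewrite conjgE -(centerC Sh Zz) mulKg.
Qed.

Lemma Aut_by_der1 a x :
  a \in P -> x \in M -> exists2 w, w \in S^`(1) & a x = x * w.
Proof.
move=> Pa Mx; have [h Sh ->//] := Aut_byP Pa.
exists [~ x, h]; last by rewrite commgEl mulKVg.
by rewrite mem_commg // (subsetP sMS).
Qed.

Lemma fus_Aut_hom a : a \in G -> fus_hom F M M a.
Proof. by rewrite inE => /andP[]. Qed.

(** By [Sylow_p_elt_cent] it suffices that for each b in P^g the group P^b centralizes P. Both
    groups fix [Z] pointwise and move elements of [M] only by factors in [Z], so they commute. *)
Lemma fus_Aut_norm (g : {perm gT}) :
  g \in G -> (forall w, w \in S^`(1) -> g w \in Z) -> g \in 'N(P).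
Proof.
move=> Gg gS'; have sPG : P \subset G by exact: pHall_sub sylP.
have pP := pHall_pgroup sylP; have sS'Z := der1_sub_center p_pr oSZ.
have homg := fus_Aut_hom Gg.
(* If b = a^g and a sends g^-1 z to (g^-1 z) w with w in S', then b z = z (g w), and g w is central
   by assumption. *)
have Zfix b : b \in P :^ g -> forall z, z \in Z -> b z \in Z.
  case/imsetP=> a Pa -> z Zz; rewrite !permM.
  have Mgz : g^-1 z \in M.
    by rewrite (fus_hom_mem (fus_Aut_hom (groupVr Gg))) ?(subsetP sZM).
  have [w S'w ->] := Aut_by_der1 Pa Mgz.
  rewrite (fus_hom_morphM homg) ?permKV ?groupM ?gS' //.
  by rewrite (subsetP sZM) // (subsetP sS'Z).
rewrite inE; apply/subsetP=> b Pgb.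
have Gb : b \in G by rewrite -(conjGid Gg) (subsetP _ _ Pgb) // conjSg.
have homb := fus_Aut_hom Gb; have homVb := fus_Aut_hom (groupVr Gb).
apply: (Sylow_p_elt_cent sylP) => //.
  by case/imsetP: Pgb => a Pa ->; rewrite p_eltJ (mem_p_elt pP).
apply/subsetP=> _ /imsetP[a1 Pa1 ->]; apply/centP=> a2 Pa2.
have Ga1 := subsetP sPG _ Pa1; have Ga2 := subsetP sPG _ Pa2.
have Gc : a1 ^ b \in G by rewrite groupJ.
have homa2 := fus_Aut_hom Ga2; have homc := fus_Aut_hom Gc.
have [AG1 AG2] : a1 ^ b * a2 \in G /\ a2 * a1 ^ b \in G by split; apply: groupM.
apply: (eq_Aut (A := M)).
- by case/setIdP: AG1.
- by case/setIdP: AG2.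
move=> m Mm; rewrite [LHS]permM [RHS]permM.
have cE x : x \in M -> exists2 z, z \in Z & (a1 ^ b) x = x * z.
  move=> Mx; rewrite !permM; have Mbx := fus_hom_mem homVb Mx.
  have [w S'w ->] := Aut_by_der1 Pa1 Mbx; have Zw := subsetP sS'Z w S'w.
  exists (b w); first exact: Zfix.
  by rewrite (fus_hom_morphM homb) ?permKV ?(subsetP sZM w Zw).
have cZ z : z \in Z -> (a1 ^ b) z = z.
  move=> Zz; rewrite !permM (Aut_by_center Pa1) ?permKV //.
  apply: Zfix => //; exact: (@groupVr _ (conj_aut M @* 'N_S(M) :^ g)%G).
have [z1 Zz1 a2m] : exists2 z, z \in Z & a2 m = m * z.
  by have [w S'w ->] := Aut_by_der1 Pa2 Mm; exists w => //; exact: (subsetP sS'Z).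
have [z2 Zz2 cm] := cE m Mm.
have [Mz1 Mz2] : z1 \in M /\ z2 \in M by rewrite !(subsetP sZM).
rewrite a2m cm (fus_hom_morphM homc) // (fus_hom_morphM homa2) // cm a2m.
by rewrite cZ // (Aut_by_center Pa2) // -!mulgA (cM Mz1).
Qed.

Lemma fus_Aut_not_norm (g : {perm gT}) :
  g \in G -> g \notin 'N(P) -> exists2 w, w \in S^`(1) & g w \notin Z.
Proof.
move=> Gg notNg; apply/exists_inP; apply: contraR notNg => /exists_inPn gZ.
by apply: fus_Aut_norm => // w /gZ; rewrite negbK.
Qed.

Lemma der1_gen w w1 :
  w \in S^`(1) -> w1 \in S^`(1) -> w != 1 -> exists k, w1 = w ^+ k.
Proof.
move=> S'w S'w1 ntw; apply/cycleP; suffices -> : <[w]> = S^`(1) by [].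
apply/eqP; rewrite eqEcard cycle_subG S'w (card_der1 p_pr oSZ) -orderE.
rewrite dvdn_leq //.
have := order_dvdG S'w; rewrite (card_der1 p_pr oSZ) => ow.
by rewrite (prime_nt_dvdP p_pr _ ow) ?order_eq1.
Qed.

(** The centralizer of [x] in [S] contains the abelian maximal subgroup [M] and also [s], so it is
    [S]. *)
Lemma cent_outside_maximal x s :
  x \in M -> s \in S -> s \notin M -> x ^ s = x -> x \in Z.
Proof.
move=> Mx Ss M's xs; have Sx := subsetP sMS x Mx.
suffices defS : 'C_S[x] = S.
  by rewrite inE Sx -sub_cent1 -{1}defS subsetIr.
apply/eqP; rewrite eqEsubset subsetIl /=; apply: contraR M's => notSC.
have [_ maxP] := maxgroupP maxM.
rewrite -(maxP 'C_S[x]%G) /= ?properE ?subsetIl //.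
  by apply/setIP; split=> //; apply/cent1P/commute_sym/commgP/conjg_fixP.
by rewrite subsetI sMS sub_cent1 (subsetP cMM).
Qed.

(** [Z <*> <[v]>] is maximal in [S] and contained in [M], hence equal to [M]. *)
Lemma center_cycle_decomp v x :
  v \in M -> v \notin Z -> x \in M ->
  exists2 z, z \in Z & exists i, x = z * v ^+ i.
Proof.
move=> Mv Z'v Mx; have Sv := subsetP sMS v Mv.
apply: (center_cycleP Sv).
have [_ maxP] := maxgroupP (maximal_center_cycle p_pr oSZ Sv Z'v).
by rewrite -(maxP M) ?(maxgroupp maxM) // join_subG sZM cycle_subG.
Qed.

(* If the Sylow p-subgroup P of Aut_F(M) is not normal, then a generator x of P
   and a suitable conjugate y of x act on <v, u> by v -> vu and u -> u v^-1, and
   (x y x)^2 is the central involution of the SL_2(p) they generate. *)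
Lemma exists_inverting_Aut (g : {perm gT}) :
  g \in G -> g \notin 'N(P) ->
  exists t v, [/\ t \in G, v \in M, v \notin Z, t v = v^-1
    & forall a x, a \in P -> x \in M -> t (a x) = a (t x)].
Proof.
move=> Gg notNg; have sPG : P \subset G by exact: pHall_sub sylP.
have sS'Z := subsetP (der1_sub_center p_pr oSZ); have sZM' := subsetP sZM.
have GVg := groupVr Gg.
have [homg homVg] := (fus_Aut_hom Gg, fus_Aut_hom GVg).
have [w S'w Z'v] := fus_Aut_not_norm Gg notNg.
have [w' S'w' Z'w'] : exists2 w, w \in S^`(1) & g^-1 w \notin Z.
  apply: fus_Aut_not_norm => //.
  by rewrite (@groupV _ 'N(conj_aut M @* 'N_S(M))%G).
have ntw : w != 1.
  by apply: contraNneq Z'v => ->; rewrite (fus_hom1 homg) group1.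
set v := g w in Z'v; have Mv : v \in M by rewrite (fus_hom_mem homg) ?sZM' ?sS'Z.
have [_ [s Ss M's]] := properP (maxgroupp maxM).
pose x := conj_aut M s; have Px : x \in P by exact: Aut_by_conj.
have Gx := subsetP sPG x Px; have homx := fus_Aut_hom Gx.
have xE m : m \in M -> x m = m ^ s.
  by move=> Mm; rewrite norm_conj_autE // (subsetP nMS).
have [u S'u xv] := Aut_by_der1 Px Mv.
have Zu := sS'Z u S'u; have Mu := sZM' u Zu.
have ntu : u != 1.
  apply: contraNneq Z'v => u1; apply: (cent_outside_maximal Mv Ss M's).
  by rewrite -xE // xv u1 mulg1.
have xZ := Aut_by_center Px.
have Mgu := fus_hom_mem homVg Mu.
(* S' has order p, so [u] generates it; were g^-1 u central, g^-1 would map all of S' into [Z],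
   against the choice of [w']. *)
have Z'gu : g^-1 u \notin Z.
  apply: contra Z'w' => Zgu; have [k ->] := der1_gen S'u S'w' ntu.
  by rewrite (fus_homX _ homVg) // groupX.
have [w2 S'w2 xgu] := Aut_by_der1 Px Mgu.
have Zw2 := sS'Z w2 S'w2.
have ntw2 : w2 != 1.
  apply: contraNneq Z'gu => w1; apply: (cent_outside_maximal Mgu Ss M's).
  by rewrite -xE // xgu w1 mulg1.
(* The conjugate [y] multiplies [u] by [g w2]. Choosing [k] with w2^k = w^-1 makes y^k multiply [u]
   by g w^-1 = v^-1. *)
have [k defw] := der1_gen S'w2 (groupVr S'w) ntw2.
pose y := x ^ g; have Gy : y \in G by rewrite groupJ.
have homy := fus_Aut_hom Gy.
have yE m : y m = g (x (g^-1 m)) by rewrite !permM.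
have yfix z : z \in Z -> y (g z) = g z by move=> Zz; rewrite yE permK xZ.
have yu : y u = u * g w2.
  by rewrite yE xgu (fus_hom_morphM homg) ?permKV // sZM'.
have yXfix n z : z \in Z -> (y ^+ n) (g z) = g z.
  move=> Zz; elim: n => [|n IHn]; first by rewrite perm1.
  by rewrite expgSr permM IHn yfix.
have yXu n : (y ^+ n) u = u * g w2 ^+ n.
  elim: n => [|n IHn]; first by rewrite perm1 mulg1.
  rewrite expgSr permM IHn -(fus_homX _ homg) ?sZM' //.
  rewrite (fus_hom_morphM homy) ?yu ?yfix ?groupX //; last first.
    by rewrite (fus_hom_mem homg) // groupX ?sZM'.
  by rewrite -mulgA (fus_homX _ homg) ?sZM' // -expgS.
pose y1 := y ^+ k; have Gy1 : y1 \in G by rewrite groupX.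
have homy1 := fus_Aut_hom Gy1.
have y1v : y1 v = v by rewrite yXfix ?sS'Z.
have y1u : y1 u = u * v^-1.
  by rewrite yXu -(fus_homX _ homg) ?sZM' // -defw (fus_homV homg) ?sZM' ?sS'Z.
(* This is a Weyl element: it sends v to u and u to v^-1, so its square inverts both. *)
pose t0 := x * y1 * x; have Gt0 : t0 \in G by rewrite !groupM.
have homt0 := fus_Aut_hom Gt0.
have t0v : t0 v = u.
  rewrite !permM xv (fus_hom_morphM homy1) // y1v y1u (cM Mu) ?groupV //.
  by rewrite mulKVg xZ.
have t0u : t0 u = v^-1.
  rewrite !permM (xZ u Zu) y1u (fus_hom_morphM homx) ?groupV //.
  by rewrite (fus_homV homx) // xv (xZ u Zu) invMg mulKVg.
have t0d z : z \in Z -> g z \in Z -> t0 (g z) = g z.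
  by move=> Zz Zgz; rewrite !permM (xZ _ Zgz) yXfix // xZ.
pose t := t0 * t0; have Gt : t \in G by rewrite groupM.
have tv : t v = v^-1 by rewrite permM t0v.
have tu : t u = u^-1 by rewrite permM t0u (fus_homV homt0) // t0v.
have homt := fus_Aut_hom Gt.
exists t, v; split=> // a m Pa Mm.
have [z Zz [i ->]] := center_cycle_decomp Mv Z'v Mm.
(* Decomposing g^-1 z along g^-1 u and applying g gives z = d u^j with d = g z1 in the intersection
   of Z and g(Z), where [t] is trivial. So commutation with [a] need only be checked on d, u and
   v. *)
have [z1 Zz1 [j defz]] :=
  center_cycle_decomp Mgu Z'gu (fus_hom_mem homVg (sZM' z Zz)).
have defz1 : z = g z1 * u ^+ j.
  have := congr1 g defz.
  rewrite permKV (fus_hom_morphM homg) ?groupX ?(sZM' z1 Zz1) //.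
  by rewrite (fus_homX _ homg) // permKV.
have Zd : g z1 \in Z by move: Zz; rewrite defz1 groupMr ?groupX.
set d := g z1 in defz1 Zd; have Md := sZM' d Zd.
have td : t d = d by rewrite permM !t0d.
clearbody t.
have homE b : b \in G -> b (z * v ^+ i) = b d * b u ^+ j * b v ^+ i.
  move=> Gb; have homb := fus_Aut_hom Gb.
  rewrite defz1 !(fus_hom_morphM homb) ?groupM ?groupX //.
  by rewrite !(fus_homX _ homb).
have Ga := subsetP sPG a Pa; have homa := fus_Aut_hom Ga.
have [r S'r av] := Aut_by_der1 Pa Mv; have [l defr] := der1_gen S'u S'r ntu.
have Mr := sZM' r (sS'Z r S'r).
have tr : t r = r^-1 by rewrite defr (fus_homX _ homt) // tu expVgn.
have aZ := Aut_by_center Pa.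
have [GatE GtaE] : a * t \in G /\ t * a \in G by split; apply: groupM.
rewrite -!permM !homE // !permM (aZ d Zd) (aZ u Zu).
rewrite td tu tv av (aZ d Zd) aZ ?groupV //.
rewrite (fus_hom_morphM homt) // tv tr (fus_homV homa) // av.
by rewrite (cM Mv) // invMg.
Qed.

(** The second hypothesis says that [f] conjugates Aut_S(M) into itself, so [ext_dom M M f] is all
    of [S] and receptivity applies. *)
Lemma receptive_extension f :
  fus_hom F M M f ->
  (forall a, a \in P ->
     exists2 b, b \in P & {in M, forall x, f (a x) = b (f x)}) ->
  exists2 f1, fus_hom F S S f1 & {in M, f1 =1 f}.
Proof.
move=> homf normf; have [_ recM] := maximal_receptive maxM.
have isof := fus_hom_iso homf (esym (fus_hom_endo_image homf)).
have [f1 homf1 eq_f1] := recM M f isof; exists f1 => //.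
apply: fus_hom_sub homf1 => //; apply/subsetP=> h Sh.
rewrite inE inE Sh (subsetP nMS h Sh) /=; apply/exists_inP.
have [b Pb fb] := normf _ (Aut_by_conj Sh); exists b => //.
apply/forall_inP=> x Mx.
by rewrite -fb // norm_conj_autE // (subsetP nMS).
Qed.

Lemma inverting_Aut_center t v :
  t \in G -> (forall a x, a \in P -> x \in M -> t (a x) = a (t x)) ->
  v \in M -> t v = v^-1 -> v \in Z.
Proof.
move=> Gt tP Mv tv; have homt := fus_Aut_hom Gt; have sZM' := subsetP sZM.
have [f homf eq_ft] : exists2 f, fus_hom F S S f & {in M, f =1 t}.
  by apply: receptive_extension => // a Pa; exists a => // x Mx; exact: tP.
apply: contraT => Z'v; have Sv := subsetP sMS v Mv.
(* Evaluating f on v^s in two ways shows that f s and s conjugate v^-1 alike, so their quotient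
   centralizes v^-1; outside [M] it would make [v] central. *)
have fM s : s \in S -> f s * s^-1 \in M.
  move=> Ss; have Sfs := fus_hom_mem homf Ss; apply: contraR Z'v => M'd.
  have Sd : f s * s^-1 \in S by rewrite groupM ?groupV.
  rewrite -groupV; apply: cent_outside_maximal Sd M'd _; first by rewrite groupV.
  have tvs : t (v ^ s) = t v ^ s.
    have := tP _ _ (Aut_by_conj Ss) Mv; rewrite !norm_conj_autE ?(subsetP nMS) //.
    by rewrite (fus_hom_mem homt).
  have Mvs : v ^ s \in M by rewrite memJ_norm ?(subsetP nMS).
  by rewrite conjgM -tv -{1}eq_ft // -(fus_homJ homf) // eq_ft // tvs conjgK.
(* [f] preserves the maximal subgroup [Z <*> <[r]>], which meets [M] in [Z]. *)
have fZ r : r \in S -> r \notin M -> f r * r^-1 \in Z.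
  move=> Sr M'r; have Z'r := contra (sZM' r) M'r.
  have maxZr := maximal_center_cycle p_pr oSZ Sr Z'r.
  have Zr : r \in Z <*> <[r]> by rewrite -cycle_subG joing_subr.
  apply: (center_cycle_cap p_pr pS oSZ sZM Sr M'r); last exact: fM.
  rewrite groupM ?groupV //.
  have sZrS : Z <*> <[r]> \subset S by rewrite join_subG center_sub cycle_subG.
  apply: (fus_hom_mem (P := (Z <*> <[r]>)%G)) Zr.
  exact: maximal_fus_hom maxZr (fus_hom_sub sZrS _ _ homf).
have [_ [s Ss M's]] := properP (maxgroupp maxM).
have Zs := fZ s Ss M's.
(* Comparing the central elements obtained from s and from s v shows that v^2 is central. So is v^p,
   and as p is odd [v] is central. *)
have := fZ (s * v); rewrite groupM // groupMr // => /(_ isT M's).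
rewrite (fus_hom_morphM homf) // (eq_ft v Mv) tv invMg.
have -> : f s * v^-1 * (v^-1 * s^-1) = f s * s^-1 * (v ^- 2) ^ s^-1.
  by rewrite conjgE invgK -!mulgA mulKg expgS expg1 invMg -!mulgA.
rewrite groupMl // memJ_norm ?groupV; last first.
  by rewrite (subsetP (normal_norm (center_normal S))).
move=> Zv2; have := expgp_center p_pr oSZ Sv.
rewrite -(odd_double_half p) p_odd expgS -mul2n expgM.
by rewrite (groupMr _ (groupX _ Zv2)) (negPf Z'v).
Qed.

(** If [f] did not normalize Aut_S(M), the element [v] inverted by [t] would be both central and
    noncentral. *)
Lemma fus_Aut_extension f :
  fus_hom F M M f -> exists2 f1, fus_hom F S S f1 & {in M, f1 =1 f}.
Proof.
move=> homf; have [g Gg eq_gf] := fus_hom_Aut homf.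
have Ng : g \in 'N(P).
  apply: contraT => notNg.
  have [t [v [Gt Mv Z'v tv tP]]] := exists_inverting_Aut Gg notNg.
  by rewrite (inverting_Aut_center Gt tP Mv tv) in Z'v.
apply: receptive_extension => // a Pa; exists (a ^ g); first by rewrite memJ_norm.
move=> x Mx; have Max : a x \in M.
  have [h Sh -> //] := Aut_byP Pa; rewrite memJ_norm //; exact: subsetP Sh.
by rewrite -!eq_gf // !permM permK.
Qed.

End MaximalExtension.

End Fusion.

(** * Invariant subgroups and the cyclic series *)

Section Control.

Variables (p : nat) (gT : finGroupType) (S : {group gT}) (F : fusion_system S).
Implicit Types (P Q R T M : {group gT}) (f g : gT -> gT).

Hypotheses (p_pr : prime p) (p_odd : odd p) (pS : p.-group S).
Hypothesis satF : saturated F p.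
Hypothesis wclF : forall M : {group gT}, maximal M S -> weakly_closed F M.

(** Receptivity extends [f] to K = P C_S(P), which contains [Z(S)]. If [P] is central in [S], then K
    = S; the only other possibility is that K is maximal, and there [fus_Aut_extension] takes
    over. *)
Lemma receptive_iso_extension P Q f :
  abelian S \/ #|S : 'Z(S)| = (p ^ 2)%N -> receptive F Q -> fus_iso F P Q f ->
  exists2 f1, fus_hom F S S f1 & {in P, f1 =1 f}.
Proof.
move=> abS_or recQ isof; have [homf _] := isof.
have [sPS sQS] := fus_hom_obj homf.
have [f1 homf1 eq_f1] := recQ P f isof.
pose K := (P <*> 'C_S(P))%G.
have sPK : P \subset K by exact: joing_subl.
have sCK : 'C_S(P) \subset K by exact: joing_subr.
have sKS : K \subset S by rewrite join_subG sPS subsetIl.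
have sZK : 'Z(S) \subset K.
  by apply: subset_trans sCK; rewrite setIS // centS.
(* [K] lies in the extension domain: [g] in [P] corresponds to conjugation by [f g] on [Q], and [g]
   centralizing [P] to the identity. *)
have {}homf1 : fus_hom F K S f1.
  apply: fus_hom_sub homf1 => //; rewrite join_subG; apply/andP; split.
    apply/subsetP=> g Pg; rewrite inE inE (subsetP sPS) // (subsetP (normG P)) //.
    have Qfg := fus_hom_mem homf Pg; have Nfg := subsetP (normG Q) _ Qfg.
    apply/exists_inP; exists (conj_aut Q (f g)).
      by apply: mem_morphim => //; rewrite inE (subsetP sQS).
    apply/forall_inP=> x Px; rewrite norm_conj_autE ?(fus_hom_mem homf) //.
    by rewrite (fus_homJ homf).
  apply/subsetP=> g /setIP[Sg Cg]; rewrite inE inE Sg (subsetP (cent_sub P)) //=.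
  apply/exists_inP; exists 1; first exact: group1.
  apply/forall_inP=> x Px; rewrite perm1 conjgE -(centP Cg) // mulKg.
  by [].
suffices [f2 homf2 eq_f2] : exists2 f2, fus_hom F S S f2 & {in K, f2 =1 f1}.
  by exists f2 => // x Px; rewrite eq_f2 ?eq_f1 ?(subsetP sPK).
have extS : K :=: S -> exists2 f2, fus_hom F S S f2 & {in K, f2 =1 f1}.
  by move=> defK; exists f1 => //; apply: fus_hom_sub homf1; rewrite // defK.
have cPS : S \subset 'C(P) -> K :=: S.
  by move=> cPS; apply/eqP; rewrite eqEsubset sKS -{1}(setIidPl cPS).
case: abS_or => [cSS | oSZ]; first by apply/extS/cPS/(subset_trans cSS)/centS.
have [defK|defK|maxK] := index_over_center p_pr oSZ sZK sKS.
- exact: extS defK.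
- apply/extS/cPS; rewrite centsC; apply: subset_trans sPK _.
  by rewrite defK subsetIr.
apply: (fus_Aut_extension p_pr p_odd pS satF wclF oSZ maxK sZK).
exact: maximal_fus_hom homf1.
Qed.

(** Let [e] map the image [R] of [f] onto a receptive conjugate. Both e f and e extend to
    automorphisms f1 and f2 of [S] preserving [T], and on [P] the map f is f1 followed by the
    inverse of f2. *)
Lemma strongly_closed_invariant T :
  abelian S \/ #|S : 'Z(S)| = (p ^ 2)%N -> T \subset S ->
  (forall f, fus_hom F S S f -> f @: T \subset T) -> strongly_closed F T.
Proof.
move=> abS_or sTS invT; split=> // P f sPT homf.
have [R [defR homfR _]] := fus_hom_factor homf.
have isof := fus_hom_iso homf defR.
have [_ sRP] := fus_hom_obj homfR.
have [Q [[e isoe] _ recQ]] := satF sRP.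
have [f1 homf1 eq_f1] :=
  receptive_iso_extension abS_or recQ (fus_iso_comp isof isoe).
have [f2 homf2 eq_f2] := receptive_iso_extension abS_or recQ isoe.
apply/subsetP=> _ /imsetP[x Px ->]; have Tx := subsetP sPT x Px.
have imT : f2 @: T = T.
  apply/eqP; rewrite eqEcard invT //= card_in_imset //.
  by apply: sub_in2 (fus_hom_inj homf2); exact: subsetP.
have [y Ty eq_y] : exists2 y, y \in T & f1 x = f2 y.
  by apply/imsetP; rewrite imT (subsetP (invT _ homf1)) // imset_f.
suffices -> : f x = y by [].
apply: (fus_hom_inj homf2); [exact: fus_hom_mem homf Px | exact: subsetP Ty |].
by rewrite -eq_y eq_f1 // eq_f2 // defR imset_f.
Qed.

(** The condition in [supersolvable] with an arbitrary top [T], so that a series can be built from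
    below one factor at a time. *)
Definition cyclic_series T : Prop :=
  exists (m : nat) (U : nat -> {group gT}),
    [/\ U 0 :=: 1, U m :=: T,
        forall i, i < m -> U i \subset U i.+1,
        forall i, i <= m -> strongly_closed F (U i)
      & forall i, i < m -> cyclic (U i.+1 / U i)].

Lemma strongly_closed1 : strongly_closed F 1%G.
Proof.
split=> [|P f /trivgP P1 homf]; first exact: sub1G.
by rewrite P1 imset_set1 (fus_hom1 homf).
Qed.

Lemma strongly_closedT : strongly_closed F S.
Proof. by split=> // P f _ /fus_hom_inj_morph[]. Qed.

Lemma cyclic_series1 : cyclic_series 1%G.
Proof.
by exists 0, (fun=> 1%G); split=> // i _; exact: strongly_closed1.
Qed.

Lemma cyclic_series_step T T' :
  cyclic_series T -> T \subset T' -> strongly_closed F T' -> cyclic (T' / T) ->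
  cyclic_series T'.
Proof.
case=> m [U [U0 Um sU clU cycU]] sTT' clT' cycT'.
exists m.+1, (fun i => if i <= m then U i else T'); split=> //.
- by rewrite ltnn.
- move=> i; rewrite ltnS => lim; rewrite lim; case: ltnP => [/sU //|lemi].
  by have -> : i = m by [apply/eqP; rewrite eqn_leq lim]; rewrite Um.
- by move=> i _; case: leqP => // /clU.
move=> i; rewrite ltnS => lim; rewrite lim; case: ltnP => [/cycU //|lemi].
by have -> : i = m by [apply/eqP; rewrite eqn_leq lim]; rewrite Um.
Qed.

(** Otherwise some maximal subgroup contains [<[x]> <*> 'Phi(S)] but not [f x], although weak
    closure makes it [f]-invariant. *)
Lemma fus_hom_image_mod_Phi f x :
  fus_hom F S S f -> x \in S -> f x \in <[x]> <*> 'Phi(S).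
Proof.
move=> homf Sx; apply: contraT => N'fx.
have sNS : <[x]> <*> 'Phi(S) \subset S by rewrite join_subG cycle_subG Sx Phi_sub.
have Sfx := fus_hom_mem homf Sx.
have [M [maxM sNM]] :=
  maximal_avoiding (N := (<[x]> <*> 'Phi(S))%G) p_pr pS (joing_subr _ _) sNS Sfx N'fx.
have [sMS clM] := wclF maxM.
rewrite -{1}(clM f) ?imset_f //.
  by rewrite (subsetP sNM) // -cycle_subG joing_subl.
exact: fus_hom_sub homf.
Qed.

(** As [S / T] is abelian, the p^j-th power map from [S] to it is a homomorphism; its image is
    elementary abelian, so it kills the Frattini subgroup. *)
Lemma expg_Phi_mem T j x :
  S^`(1) \subset T -> T \subset S ->
  (forall y, y \in S -> y ^+ (p ^ j.+1) \in T) ->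
  x \in 'Phi(S) -> x ^+ (p ^ j) \in T.
Proof.
move=> sS'T sTS expT Phix; have nTS := sub_der1_norm sS'T sTS.
have cSS := sub_der1_abelian sS'T.
pose phi y := coset T y ^+ (p ^ j).
have phiM : {in S &, {morph phi : y z / y * z}}.
  move=> y z Sy Sz; rewrite /phi morphM ?(subsetP nTS) // expgMn //.
  by apply: (centsP cSS); rewrite mem_quotient.
have abelphi : p.-abelem (Morphism phiM @* S).
  apply/abelemP=> //; split.
    apply/centsP=> _ /morphimP[y _ Sy ->] _ /morphimP[z _ Sz ->].
    by apply: commuteX2; apply: (centsP cSS); rewrite mem_quotient.
  move=> _ /morphimP[y _ Sy ->]; rewrite /= /phi -expgM -expnSr.
  have nTy := subsetP nTS y Sy; rewrite -(morphX (coset_morphism T)) //.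
  by apply: coset_id; exact: expT.
have Sx := subsetP (Phi_sub S) x Phix.
have: phi x \in 'Phi(Morphism phiM @* S).
  by rewrite -(morphim_Phi _ pS) // (mem_morphim (Morphism phiM)).
have /eqP -> : 'Phi(Morphism phiM @* S) == 1.
  by rewrite (trivg_Phi (morphim_pgroup _ pS)).
move/set1P => phix; apply: coset_idr; first by rewrite groupX ?(subsetP nTS).
by rewrite morphX ?(subsetP nTS).
Qed.

Lemma cyclic_series_from_der1 T :
  abelian S \/ #|S : 'Z(S)| = (p ^ 2)%N -> S^`(1) \subset T ->
  strongly_closed F T -> cyclic_series T -> cyclic_series S.
Proof.
move=> abS_or; have [n] := ubnP #|S : T|; elim: n T => // n IHn T ltn sS'T.
move=> clT serT; have [sTS clTS] := clT; have nTS := sub_der1_norm sS'T sTS.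
(* For proper [T], let p^(j+1) be the exponent of [S / T] and take a = x^(p^j) outside [T]; the next
   term of the series is T<a>. *)
have [defT | ltTS] := eqVproper sTS; first by rewrite -(group_inj defT).
have expT : exists i, [forall x in S, x ^+ (p ^ i) \in T].
  have [k oS] := p_natP pS; exists k; apply/forall_inP=> x Sx.
  by rewrite -oS expg_cardG ?group1.
case: (ex_minnP expT) => [[|j]] /forall_inP expTj minj.
  by case/subsetPn: (proper_subn ltTS) => x Sx; rewrite -[x]expg1 expTj.
have /forall_inPn[x Sx T'a] : ~~ [forall x in S, x ^+ (p ^ j) \in T].
  by apply/negP=> /minj; rewrite ltnn.
set a := x ^+ _ in T'a; have Sa : a \in S by rewrite groupX.
have nTa := subsetP nTS a Sa.
have sTaS : T <*> <[a]> \subset S by rewrite join_subG sTS cycle_subG.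
have sTTa := joing_subl T <[a]>.
have aTa : a \in (T <*> <[a]>)%G by rewrite -cycle_subG joing_subr.
have clTa : strongly_closed F (T <*> <[a]>)%G.
  apply: strongly_closed_invariant => // f homf.
  have fT y : y \in T -> f y \in T.
    move=> Ty; apply: (subsetP (clTS T f _ _)) => //; last exact: imset_f.
    exact: fus_hom_sub homf.
  (* Write f x = x^i y with y in Phi(S). Modulo [T] the p^j-th power of [y] vanishes, so f a is
     congruent to a^i. *)
  have faT : f a \in T <*> <[a]>.
    rewrite (fus_homX _ homf) //; have := fus_hom_image_mod_Phi homf Sx.
    have nPhix : <[x]> \subset 'N('Phi(S)).
      by rewrite cycle_subG (subsetP (normal_norm (Phi_normal S))).
    rewrite norm_joinEl // => /mulsgP[_ y /cycleP[i ->] Phiy ->].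
    have Sy := subsetP (Phi_sub S) y Phiy.
    have Sxi : x ^+ i \in S by rewrite groupX.
    have Ty := expg_Phi_mem sS'T sTS expTj Phiy.
    have nTxi := subsetP nTS _ Sxi; have nTy := subsetP nTS y Sy.
    have eq_a : coset T ((x ^+ i * y) ^+ (p ^ j)) = coset T (a ^+ i).
      rewrite morphX ?groupM // morphM // expgMn; last first.
        by apply: (centsP (sub_der1_abelian sS'T)); rewrite mem_quotient.
      have <- : coset T (y ^+ (p ^ j)) = coset T y ^+ (p ^ j) by rewrite morphX.
      rewrite (coset_id Ty) mulg1 -(morphX (coset_morphism T)) //.
      by rewrite -!expgM mulnC.
    have [||z Tz ->] := kercoset_rcoset _ _ eq_a; try by rewrite groupX ?groupM.
    by rewrite groupM ?(groupX i aTa) // (subsetP sTTa).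
  apply/subsetP=> _ /imsetP[y Tay ->].
  have /mulsgP[z _ Tz /cycleP[i ->] ->] : y \in T * <[a]>.
    by rewrite -norm_joinEr ?cycle_subG.
  have Sz := subsetP sTS z Tz.
  rewrite (fus_hom_morphM homf) ?groupX // (fus_homX _ homf) //.
  by rewrite groupM ?groupX // (subsetP sTTa) ?fT.
apply: (IHn (T <*> <[a]>)%G _ _ clTa); last first.
- apply: (cyclic_series_step serT sTTa clTa).
  by rewrite quotientYidl ?cycle_subG // quotient_cyclic ?cycle_cyclic.
- exact: subset_trans sS'T sTTa.
- rewrite ltnS in ltn; apply: leq_trans ltn.
  rewrite -(Lagrange_index sTaS sTTa) ltn_Pmulr ?indexg_gt1 //.
  by apply: contra T'a => sTaT; rewrite (subsetP sTaT) // -cycle_subG joing_subr.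
Qed.

Lemma der1_invariant f : fus_hom F S S f -> f @: S^`(1) \subset S^`(1).
Proof.
move=> homf; have fM := fus_hom_morphM homf.
rewrite -(morphimEsub (Morphism fM)) ?der_sub // morphim_der //.
by rewrite morphimEdom (fus_hom_endo_image homf).
Qed.

End Control.

(** * Two abelian maximal subgroups and the conclusion *)

Lemma index_center_two_abelian_maximal
    (p : nat) (gT : finGroupType) (S A B : {group gT}) :
  prime p -> p.-group S -> maximal A S -> maximal B S -> abelian A -> abelian B ->
  A != B -> abelian S \/ #|S : 'Z(S)| = (p ^ 2)%N.
Proof.
move=> p_pr pS maxA maxB cAA cBB neqAB.
have [[sAS _] [sBS _]] := (andP (maxgroupp maxA), andP (maxgroupp maxB)).
have nsAS := p_maximal_normal pS maxA.
have nAB := subset_trans sBS (normal_norm nsAS).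
have defS : A * B = S.
  rewrite -norm_joinEr //.
  have sABS : A <*> B \subset S by rewrite join_subG sAS.
  apply/eqP; rewrite eqEproper sABS; apply/negP=> ltABS.
  case/negP: neqAB; apply/eqP/val_inj.
  have [[_ maxPA] [_ maxPB]] := (maxgroupP maxA, maxgroupP maxB).
  have eqA := maxPA (A <*> B)%G ltABS (joing_subl _ _).
  exact: etrans (esym eqA) (maxPB (A <*> B)%G ltABS (joing_subr _ _)).
(* The intersection is centralized by [A] and by [B], hence by S = AB. Its index p^2 bounds that of
   the center, and index p would make S/Z(S) cyclic. *)
have sABZ : A :&: B \subset 'Z(S).
  rewrite subsetI (subset_trans (subsetIl _ _) sAS) /= centsC -defS mul_subG //.
    by rewrite centsC (subset_trans (subsetIl _ _) cAA).
  by rewrite centsC (subset_trans (subsetIr _ _) cBB).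
have oAB : #|S : A :&: B| = (p * p)%N.
  rewrite -(Lagrange_index sAS (subsetIl A B)) (p_maximal_index pS maxA).
  congr (_ * _)%N; rewrite indexgI -(p_maximal_index pS maxB).
  by rewrite -defS -(normC nAB) indexMg.
have dvZ : #|S : 'Z(S)| %| p ^ 2.
  by rewrite -mulnn -oAB -(Lagrange_index (center_sub S) sABZ) dvdn_mulr.
have /(dvdn_pfactor _ _ p_pr)[[|[|[|//]]] _ oZ] := dvZ.
- by left; apply: abelianS (center_abelian S); rewrite -indexg_eq1 oZ.
- left; apply: cyclic_center_factor_abelian; rewrite prime_cyclic //.
  by rewrite card_quotient ?normal_norm ?center_normal // oZ expn1.
by right.
Qed.

Theorem theorem3 (p : nat) (gT : finGroupType) (S : {group gT})
    (F : fusion_system S) :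
  prime p -> odd p -> p.-group S -> saturated F p ->
  (forall M : {group gT}, maximal M S -> weakly_closed F M) ->
  (~~ cyclic S ->
     (1 < #|[set M : {group gT} | maximal M S & abelian M]|)%N) ->
  supersolvable F.
Proof.
move=> p_pr p_odd pS satF wclF abmax.
have [cycS | /abmax/card_gt1P[A [B []]]] := boolP (cyclic S).
  apply: (cyclic_series_step (cyclic_series1 F) (sub1G S)).
    exact: strongly_closedT.
  exact: quotient_cyclic.
rewrite !inE => /andP[maxA cAA] /andP[maxB cBB] neqAB.
have abS_or := index_center_two_abelian_maximal p_pr pS maxA maxB cAA cBB neqAB.
have clS' : strongly_closed F S^`(1)%G.
  apply: (strongly_closed_invariant p_pr p_odd pS satF wclF abS_or (der_sub 1 S)).
  exact: der1_invariant.
apply: (cyclic_series_from_der1 p_pr p_odd pS satF wclF abS_or _ clS') => //.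
(* The first factor is S' itself, trivial for abelian [S] and of order p otherwise. *)
apply: (cyclic_series_step (cyclic_series1 F) (sub1G _) clS').
apply: quotient_cyclic; case: abS_or => [/derG1P/= -> | oSZ]; first exact: cyclic1.
by rewrite prime_cyclic // (card_der1 p_pr oSZ).
Qed.
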